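(* Let $M_-,M_+\in\mathbb{Z}$ with $M:=M_-+M_+\geq 2$. Then the following identities hold between polynomials in $\xi\in\mathbb{R}$: (a) $\alpha_{R_1,M_--1,M_+,M_+}(\xi)=(-1)^{M-1}\,\alpha_{R_1,M_-,M_+-1,-M_-}(\xi)$; (b) $\alpha_{R_1,M_-,M_+-1,\ell}\neq\alpha_{R_1,M_--1,M_+,\ell}$ (as polynomials) for all $\ell\in\{-M_-+1,\dots,M_+-1\}$; (c) $\lambda_{R_1,M_--1,M_+,M}(\xi)=(-1)^{M-1}\,\alpha_{R_1,M_-,M_+,-M_-}(\xi)$; (d) $\lambda_{R_1,M_-,M_+-1,M}(\xi)=-\alpha_{R_1,M_-,M_+,M_+}(\xi)$; (e) $\alpha_{R_1,M_--1,M_+,M_+}(\xi)=\lambda_{R_1,M_--1,M_+,M}(\xi)-\lambda_{R_1,M_-,M_+-1,M}(\xi)$, and this polynomial is not the zero polynomial.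
   Context: For integers $N_\pm$ (of either sign) with $N:=N_-+N_+\ge0$ and $\ell\in\{-N_-,\dots,N_+\}$, put $$\alpha_{I,N_-,N_+,\ell}(\xi)=\prod_{k=-N_-,\,k\neq\ell}^{N_+}\frac{\xi-k}{\ell-k}=\sum_{m=0}^{N}a^{N_-,N_+}_{m,\ell}\,\xi^m ,$$ which defines the coefficients $a^{N_-,N_+}_{m,\ell}$. The fundamental polynomials of Lagrange reconstruction are $$\alpha_{R_1,N_-,N_+,\ell}(\xi):=\sum_{m=0}^{N}\Bigl(\sum_{k=0}^{\lfloor (N-m)/2\rfloor}\frac{\tau_{2k}\,(m+2k)!}{m!}\,a^{N_-,N_+}_{m+2k,\ell}\Bigr)\xi^m ,$$ where $\tau_0=1$ and $\tau_{2k}=-\sum_{s=0}^{k-1}\dfrac{\tau_{2s}}{2^{2k-2s}(2k-2s+1)!}$ for $k\geq1$. Let $\nu_{N_-,N_+,m,s}:=\sum_{\ell=-N_-}^{N_+}a^{N_-,N_+}_{m,\ell}\,\ell^s$. The error polynomials are, for $s\ge N+1$, $$\mu_{R_1,N_-,N_+,s}(\xi):=\sum_{k=0}^{\lfloor s/2\rfloor}\frac{-\tau_{2k}}{(s-2k)!}\xi^{s-2k}+\sum_{m=0}^{N}\Bigl(\sum_{k=0}^{\lfloor (N-m)/2\rfloor}\tau_{2k}\,\nu_{N_-,N_+,m+2k,s}\frac{(m+2k)!}{s!\,m!}\Bigr)\xi^m,$$ and, for $n\geq N+1$, $$\lambda_{R_1,N_-,N_+,n}(\xi):=\sum_{j=0}^{n-N-1}\mu_{R_1,N_-,N_+,n-j}(\xi)\,\frac{(-1)^{j+1}}{(j+1)!}\Bigl((\xi-\tfrac12)^{j+1}-(\xi+\tfrac12)^{j+1}\Bigr).$$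 *)

(* Defs.v *)
From mathcomp Require Import all_boot all_order all_algebra.
From mathcomp Require Import zify.

Set Implicit Arguments.
Unset Strict Implicit.
Unset Printing Implicit Defensive.

Import Order.TTheory GRing.Theory Num.Theory.
Local Open Scope ring_scope.

(* Number of points minus one, N = N_- + N_+. All notions below are only
   meaningful when 0 <= N_- + N_+, in which case the absolute value is inert. *)
Definition width (Nm Np : int) : nat := absz (Nm + Np).

Definition stencil (Nm Np : int) : seq int :=
  [seq - Nm + i%:Z | i <- iota 0 (width Nm Np).+1].

Lemma mem_stencil (Nm Np l : int) :
  0 <= Nm + Np -> (l \in stencil Nm Np) = (- Nm <= l <= Np).
Proof.
move=> N0; apply/mapP/idP => [[i]|lP].
  by rewrite mem_iota /width => iN ->; lia.
by exists (absz (l + Nm)); rewrite ?mem_iota /width; lia.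
Qed.

Lemma stencil_uniq (Nm Np : int) : uniq (stencil Nm Np).
Proof. by rewrite map_inj_uniq ?iota_uniq // => i j /addrI []. Qed.

Definition alphaI (R : numFieldType) (Nm Np l : int) : {poly R} :=
  \prod_(k <- stencil Nm Np | k != l)
    ((l - k)%:~R^-1 *: ('X - (k%:~R)%:P)).

Definition acoef (R : numFieldType) (Nm Np : int) (m : nat) (l : int) : R :=
  (alphaI R Nm Np l)`_m.

(* tau_seq R n = [:: tau_0; tau_2; ...; tau_(2n-2)]; the list carries the
   values needed by the course-of-values recursion (see tauE). *)
Fixpoint tau_seq (R : numFieldType) (n : nat) : seq R :=
  if n is k.+1 then
    let t := tau_seq R k in
    rcons t (if k == 0%N then 1 else
      - \sum_(s < k) t`_s / (2 ^+ (2 * k - 2 * s) * (2 * k - 2 * s + 1)`!%:R))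
  else [::].

(* tau R k is the number tau_(2k): only even indices occur. *)
Definition tau (R : numFieldType) (k : nat) : R := (tau_seq R k.+1)`_k.

Lemma size_tau_seq (R : numFieldType) (n : nat) : size (tau_seq R n) = n.
Proof. by elim: n => //= n IHn; rewrite size_rcons IHn. Qed.

Lemma nth_tau_seq (R : numFieldType) (n s : nat) :
  (s < n)%N -> (tau_seq R n)`_s = tau R s.
Proof.
elim: n => // n IHn; rewrite ltnS leq_eqVlt => /orP[/eqP -> //|sn].
by rewrite /= nth_rcons size_tau_seq sn IHn.
Qed.

Lemma tau0 (R : numFieldType) : tau R 0 = 1.
Proof. by []. Qed.

Lemma tauE (R : numFieldType) (k : nat) : (0 < k)%N ->
  tau R k =
  - \sum_(s < k) tau R s / (2 ^+ (2 * k - 2 * s) * (2 * k - 2 * s + 1)`!%:R).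
Proof.
move=> k0; rewrite {1}/tau /= nth_rcons size_tau_seq ltnn eqxx.
rewrite eqn0Ngt k0 /=; congr (- _).
by apply: eq_bigr => s _; rewrite nth_tau_seq.
Qed.

Definition alphaR1 (R : numFieldType) (Nm Np l : int) : {poly R} :=
  let N := width Nm Np in
  \sum_(m < N.+1)
    (\sum_(k < ((N - m)./2).+1)
       tau R k * (m + 2 * k)`!%:R / m`!%:R * acoef R Nm Np (m + 2 * k) l)
    *: 'X^m.

Definition nu (R : numFieldType) (Nm Np : int) (m s : nat) : R :=
  \sum_(l <- stencil Nm Np) acoef R Nm Np m l * l%:~R ^+ s.

Definition muR1 (R : numFieldType) (Nm Np : int) (s : nat) : {poly R} :=
  let N := width Nm Np in
  \sum_(k < (s./2).+1) (- tau R k / (s - 2 * k)`!%:R) *: 'X^(s - 2 * k)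
  + \sum_(m < N.+1)
      (\sum_(k < ((N - m)./2).+1)
         tau R k * nu R Nm Np (m + 2 * k) s
           * ((m + 2 * k)`!%:R / (s`!%:R * m`!%:R)))
      *: 'X^m.

Definition lambdaR1 (R : numFieldType) (Nm Np : int) (n : nat) : {poly R} :=
  let N := width Nm Np in
  \sum_(j < n - N)
    muR1 R Nm Np (n - j)
    * (((-1) ^+ j.+1 / j.+1`!%:R)
       *: (('X - (2^-1)%:P) ^+ j.+1 - ('X + (2^-1)%:P) ^+ j.+1)).

(* Main.v *)
From HB Require Import structures.
Require Import Defs.
From mathcomp Require Import all_boot all_order all_algebra.
From mathcomp Require Import reals.
From mathcomp Require Import zify ring.

Set Implicit Arguments.
Unset Strict Implicit.
Unset Printing Implicit Defensive.

Import Order.TTheory GRing.Theory Num.Theory.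
Local Open Scope ring_scope.

(** The reconstruction polynomials are images of the interpolation polynomials
    under the linear operator [T = \sum_k tau_(2k) D^(2k)], which preserves
    leading coefficients and hence is injective.  For [n = N + 1] the sum
    defining lambda has the single term mu, which is [T] applied to the
    interpolation error of [X^(N+1) / (N+1)!], i.e. to
    [- \prod_k (X - k) / (N+1)!].  All the claims are thus [T]-images of
    identities between products of the linear factors [X - k]. *)

(** * The operator [recon]: linearity, coefficients, injectivity *)

Section Reconstruction.
Variable R : numFieldType.
Implicit Types (p q : {poly R}) (Nm Np l : int).

(* The truncation order [K] makes the operator a finite sum; its value is
   irrelevant as soon as [size p <= K]. *)
Definition recon (K : nat) (p : {poly R}) : {poly R} :=
  \sum_(k < K) tau R k *: p^`(2 * k).

Lemma recon_is_linear K : linear (recon K).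
Proof.
move=> a p q; rewrite /recon scaler_sumr -big_split /=.
by apply: eq_bigr => k _; rewrite derivnD derivnZ scalerDr !scalerA mulrC.
Qed.
HB.instance Definition _ K :=
  GRing.isLinear.Build R {poly R} {poly R} _ (recon K) (recon_is_linear K).

(** Links the factorial quotients of the definitions to the falling factorials produced by iterated
    derivatives. *)
Lemma fact_ratio m n : (m + n)`!%:R / m`!%:R = ((m + n) ^_ n)%:R :> R.
Proof.
rewrite -(@ffact_fact (m + n) n) ?leq_addl // addnK natrM mulfK //.
by rewrite pnatr_eq0 -lt0n fact_gt0.
Qed.

Lemma coef_recon K p m : (recon K p)`_m =
  \sum_(k < K) tau R k * (m + 2 * k)`!%:R / m`!%:R * p`_(m + 2 * k).
Proof.
rewrite /recon coef_sum; apply: eq_bigr => k _.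
rewrite coefZ coef_derivn [(2 * k + m)%N]addnC.
by rewrite -[p`_(m + 2 * k) *+ _]mulr_natl -fact_ratio !mulrA.
Qed.

(** Past [k = (N - m)./2] the index [m + 2 * k] exceeds [N], hence the degree of [p], so the two
    ranges differ only by zero terms. *)
Lemma coef_recon_trunc K N p m : (size p <= N.+1)%N -> (N < K)%N ->
  (recon K p)`_m = \sum_(k < ((N - m)./2).+1)
    tau R k * (m + 2 * k)`!%:R / m`!%:R * p`_(m + 2 * k).
Proof.
move=> sp NK; rewrite coef_recon.
pose F k := tau R k * (m + 2 * k)`!%:R / m`!%:R * p`_(m + 2 * k).
rewrite -(big_mkord xpredT F) -[RHS](big_mkord xpredT F).
rewrite (@big_cat_nat _ _ _ ((N - m)./2).+1) //=; last by lia.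
rewrite [X in _ + X]big_nat_cond [X in _ + X]big1 ?addr0 // => k /andP[/andP[lek _] _].
by rewrite /F nth_default ?mulr0 //; apply: leq_trans sp _; lia.
Qed.

Lemma reconE K N p : (size p <= N.+1)%N -> (N < K)%N ->
  recon K p = \sum_(m < N.+1)
    (\sum_(k < ((N - m)./2).+1)
       tau R k * (m + 2 * k)`!%:R / m`!%:R * p`_(m + 2 * k)) *: 'X^m.
Proof.
move=> sp NK; apply/polyP => i.
rewrite -(poly_def N.+1 (fun m => \sum_(k < ((N - m)./2).+1)
  tau R k * (m + 2 * k)`!%:R / m`!%:R * p`_(m + 2 * k))) coef_poly.
case: ltnP => iN; first exact: coef_recon_trunc.
rewrite coef_recon big1 // => k _.
by rewrite nth_default ?mulr0 //; apply: leq_trans sp _; lia.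
Qed.

(** Derivatives lower the degree, so in the top degree of [p - q] only the term [k = 0] survives,
    with weight [tau_0 = 1]; a zero image forces a zero leading coefficient. *)
Lemma recon_inj K : (0 < K)%N -> injective (recon K).
Proof.
case: K => // K _ p q /eqP; rewrite -subr_eq0 -linearB /= => /eqP E.
apply/eqP; rewrite -subr_eq0 -lead_coef_eq0 /lead_coef.
move: (p - q) E => r E; apply/eqP.
have := coef_recon K.+1 r (size r).-1; rewrite E coef0 big_ord_recl /= muln0 addn0.
rewrite big1 ?addr0 => [|k _].
  by rewrite tau0 mul1r mulfV ?mul1r // pnatr_eq0 -lt0n fact_gt0.
by rewrite nth_default ?mulr0 // /bump; lia.
Qed.

Lemma reconXn K s : (s < K)%N ->
  recon K (s`!%:R^-1 *: 'X^s) =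
  \sum_(k < (s./2).+1) (tau R k / (s - 2 * k)`!%:R) *: 'X^(s - 2 * k).
Proof.
move=> sK; rewrite linearZ /= /recon.
pose F k := tau R k *: ('X^s)^`(2 * k) : {poly R}.
rewrite -(big_mkord xpredT F) (@big_cat_nat _ _ _ (s./2).+1) //=; last by lia.
rewrite [X in _ + X]big_nat_cond [X in _ + X]big1 => [|k /andP[/andP[lek _] _]].
  rewrite addr0 big_mkord scaler_sumr; apply: eq_bigr => k _.
  have k2 : (2 * k <= s)%N by have := ltn_ord k; lia.
  rewrite /F derivnXn -[_ *+ (s ^_ _)]scaler_nat !scalerA; congr (_ *: _).
  have := fact_ratio (s - 2 * k) (2 * k); rewrite subnK // => <-.
  by field; rewrite !pnatr_eq0 -!lt0n !fact_gt0.
by rewrite /F derivnXn ffact_small ?mulr0n ?scaler0 //; lia.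
Qed.

(** * Stencils and their nodal polynomials *)

Definition nodal Nm Np : {poly R} :=
  \prod_(k <- stencil Nm Np) ('X - (k%:~R)%:P).

Lemma size_stencil Nm Np : size (stencil Nm Np) = (width Nm Np).+1.
Proof. by rewrite size_map size_iota. Qed.

Lemma size_nodal Nm Np : size (nodal Nm Np) = (width Nm Np).+2.
Proof. by rewrite /nodal size_prod_XsubC size_stencil. Qed.

Lemma nodal_neq0 Nm Np : nodal Nm Np != 0.
Proof. by rewrite -size_poly_eq0 size_nodal. Qed.

Lemma stencil_cons Nm Np : 0 < Nm + Np ->
  stencil Nm Np = - Nm :: stencil (Nm - 1) Np.
Proof.
move=> N0; rewrite /stencil.
have -> : width Nm Np = (width (Nm - 1) Np).+1 by rewrite /width; lia.
set n := (width _ _).+1; rewrite -[iota 0 _]/(0%N :: iota (1 + 0) n) iotaDl.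
rewrite map_cons -map_comp addr0; congr cons.
by apply: eq_map => i /=; lia.
Qed.

Lemma stencil_rcons Nm Np : 0 < Nm + Np ->
  stencil Nm Np = rcons (stencil Nm (Np - 1)) Np.
Proof.
move=> N0; rewrite /stencil.
have -> : width Nm Np = (width Nm (Np - 1)).+1 by rewrite /width; lia.
rewrite -addn1 iotaD map_cat cats1; congr rcons.
by rewrite /width; lia.
Qed.

Lemma nodal_left Nm Np : 0 < Nm + Np ->
  nodal Nm Np = ('X - ((- Nm)%:~R)%:P) * nodal (Nm - 1) Np.
Proof. by move=> N0; rewrite /nodal stencil_cons // big_cons. Qed.

Lemma nodal_right Nm Np : 0 < Nm + Np ->
  nodal Nm Np = nodal Nm (Np - 1) * ('X - (Np%:~R)%:P).
Proof. by move=> N0; rewrite /nodal stencil_rcons // -cats1 big_cat big_seq1. Qed.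

(** * Interpolation polynomials: closed forms at the end nodes, values, degrees *)

Lemma alphaIE Nm Np l : alphaI R Nm Np l =
  (\prod_(k <- stencil Nm Np | k != l) (l - k)%:~R)^-1 *:
  \prod_(k <- stencil Nm Np | k != l) ('X - (k%:~R)%:P).
Proof. by rewrite /alphaI scaler_prod prodfV. Qed.

(** A general monoid law lets one lemma serve both products of [alphaIE], the scalar one and the
    polynomial one. *)
Lemma big_stencil_left (T : Type) (idx : T) (op : Monoid.law idx) Nm Np F :
  0 < Nm + Np ->
  \big[op/idx]_(k <- stencil Nm Np | k != - Nm) F k =
  \big[op/idx]_(k <- stencil (Nm - 1) Np) F k.
Proof.
move=> N0; rewrite stencil_cons // big_cons eqxx /= big_seq_cond [RHS]big_seq.
by apply: eq_bigl => k; rewrite mem_stencil; lia.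
Qed.

Lemma big_stencil_right (T : Type) (idx : T) (op : Monoid.law idx) Nm Np F :
  0 < Nm + Np ->
  \big[op/idx]_(k <- stencil Nm Np | k != Np) F k =
  \big[op/idx]_(k <- stencil Nm (Np - 1)) F k.
Proof.
move=> N0; rewrite stencil_rcons // -cats1 big_cat /= big_cons eqxx big_nil.
rewrite /= Monoid.mulm1 big_seq_cond [RHS]big_seq.
by apply: eq_bigl => k; rewrite mem_stencil; lia.
Qed.

Lemma prod_sub_right Nm Np : 0 < Nm + Np ->
  \prod_(k <- stencil Nm (Np - 1)) (Np - k)%:~R = (width Nm Np)`!%:R :> R.
Proof.
move=> N0; rewrite /stencil big_map fact_prod natr_prod.
have -> : (width Nm (Np - 1)).+1 = width Nm Np by rewrite /width; lia.
(* The factors descend from the width to 1, so the index is reversed to match the factorial. *)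
rewrite -[X in iota 0 X]subn0 -/(index_iota 0 _) big_nat_rev big_add1 /= !big_nat.
apply: eq_bigr => i /andP[_ iN].
by rewrite pmulrn; congr (_%:~R); rewrite /width in iN *; lia.
Qed.

Lemma prod_sub_left Nm Np : 0 < Nm + Np ->
  \prod_(k <- stencil (Nm - 1) Np) (- Nm - k)%:~R =
  (-1) ^+ width Nm Np * (width Nm Np)`!%:R :> R.
Proof.
move=> N0; rewrite /stencil big_map fact_prod natr_prod.
have -> : (width (Nm - 1) Np).+1 = width Nm Np by rewrite /width; lia.
rewrite big_add1 /= big_mkord -[X in iota 0 X]subn0 -/(index_iota 0 _) big_mkord.
(* The factors are -1, -2, and so on: one sign for each index. *)
rewrite -[in X in X * _](card_ord (width Nm Np)) -prodrN.
apply: eq_bigr => i _.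
by rewrite pmulrn -rmorphN; congr (_%:~R); lia.
Qed.

Lemma alphaI_right Nm Np : 0 < Nm + Np ->
  alphaI R Nm Np Np = ((width Nm Np)`!%:R)^-1 *: nodal Nm (Np - 1).
Proof. by move=> N0; rewrite alphaIE !big_stencil_right // prod_sub_right. Qed.

Lemma alphaI_left Nm Np : 0 < Nm + Np ->
  alphaI R Nm Np (- Nm) =
  ((-1) ^+ width Nm Np / (width Nm Np)`!%:R) *: nodal (Nm - 1) Np.
Proof.
move=> N0; rewrite alphaIE !big_stencil_left // prod_sub_left //.
by rewrite invfM -signr_odd invr_sign.
Qed.

Lemma alphaI_at Nm Np l : (alphaI R Nm Np l).[l%:~R] = 1.
Proof.
rewrite /alphaI horner_prod big1 // => k kl.
by rewrite !hornerE -rmorphB mulVf // intr_eq0 subr_eq0 eq_sym.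
Qed.

Lemma root_alphaI Nm Np l k : k \in stencil Nm Np -> k != l ->
  (alphaI R Nm Np l).[k%:~R] = 0.
Proof.
move=> kS kl; rewrite /alphaI horner_prod; apply/eqP.
rewrite prodf_seq_eq0; apply/hasP; exists k => //=.
by rewrite kl !hornerE subrr mulr0 eqxx.
Qed.

(** All roots of [alphaI] are nodes; this separates the polynomials of two shifted stencils. *)
Lemma alphaI_neq0_off Nm Np l k : k \notin stencil Nm Np ->
  (alphaI R Nm Np l).[k%:~R] != 0.
Proof.
move=> kS; rewrite /alphaI horner_prod prodf_seq_neq0.
apply/allP => i iS; apply/implyP => il.
rewrite !hornerE -rmorphB mulf_neq0 ?invr_eq0 ?intr_eq0 ?subr_eq0 1?eq_sym //.
by apply: contraNneq kS => <-.
Qed.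

Lemma size_alphaI Nm Np l : l \in stencil Nm Np ->
  (size (alphaI R Nm Np l) <= (width Nm Np).+1)%N.
Proof.
move=> lS; rewrite alphaIE; apply: leq_trans (size_scale_leq _ _) _.
rewrite -big_filter size_prod_XsubC ltnS size_filter.
have := count_predC (pred1 l) (stencil Nm Np).
by rewrite size_stencil count_uniq_mem ?stencil_uniq // lS add1n => -[<-].
Qed.

Lemma size_lincomb_alphaI Nm Np (c : int -> R) :
  (size (\sum_(l <- stencil Nm Np) c l *: alphaI R Nm Np l)%R
     <= (width Nm Np).+1)%N.
Proof.
rewrite big_seq; apply: (leq_trans (size_sum _ _ _)).
apply/bigmax_leqP_seq => l _ lS.
exact: leq_trans (size_scale_leq _ _) (size_alphaI lS).
Qed.

(** * Reconstruction and error polynomials as images under [recon] *)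

Lemma alphaR1E K Nm Np l : l \in stencil Nm Np -> (width Nm Np < K)%N ->
  alphaR1 R Nm Np l = recon K (alphaI R Nm Np l).
Proof. by move=> lS NK; rewrite (reconE (size_alphaI lS) NK). Qed.

(** Both sides have degree at most [N], since the monic nodal polynomial cancels the leading power,
    and they agree at the [N + 1] distinct nodes. *)
Lemma interpolation_error Nm Np :
  \sum_(l <- stencil Nm Np) (l%:~R ^+ (width Nm Np).+1) *: alphaI R Nm Np l
  = 'X^((width Nm Np).+1) - nodal Nm Np.
Proof.
set N := width Nm Np; set L := \sum_(l <- _) _.
have sL : (size L <= N.+1)%N by exact: size_lincomb_alphaI.
have sX : (size ('X^(N.+1) - nodal Nm Np)%R <= N.+1)%N.
  apply/leq_sizeP => j; rewrite leq_eqVlt coefB coefXn => /orP[/eqP <-|Nj].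
    have := monic_prod_XsubC (stencil Nm Np) xpredT (fun k => k%:~R : R).
    by move/monicP; rewrite -/(nodal _ _) lead_coefE size_nodal => ->; rewrite eqxx subrr.
  by rewrite [(nodal _ _)`_j]nth_default ?size_nodal // subr0 gtn_eqF.
apply/eqP; rewrite -subr_eq0; apply: contraT => nz.
pose rs : seq R := [seq k%:~R | k <- stencil Nm Np].
suff /(max_poly_roots nz) : all (root (L - ('X^(N.+1) - nodal Nm Np))) rs.
  rewrite map_inj_uniq ?stencil_uniq; last exact: intr_inj.
  rewrite size_map size_stencil -/N => /(_ isT); rewrite ltnNge.
  by rewrite (leq_trans (size_polyD _ _)) // geq_max sL size_polyN sX.
apply/allP => _ /mapP[k kS ->]; rewrite rootE hornerD hornerN.
rewrite [X in _ - X]hornerD hornerN hornerXn.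
have -> : (nodal Nm Np).[k%:~R] = 0.
  apply/rootP; rewrite /nodal -(big_map (fun k => k%:~R) xpredT (fun x => 'X - x%:P)).
  by rewrite root_prod_XsubC map_f.
rewrite subr0 /L horner_sum (bigD1_seq k kS (stencil_uniq _ _)) hornerZ alphaI_at.
rewrite mulr1 big1 /= ?addr0 ?subrr // => l lk.
by rewrite hornerZ root_alphaI ?mulr0 1?eq_sym.
Qed.

(** The first sum of [muR1] comes from the monomial, the second from its interpolant, whose
    coefficients are the numbers [nu]. *)
Lemma muR1E K Nm Np s : (width Nm Np < K)%N -> (s < K)%N ->
  muR1 R Nm Np s =
  recon K (s`!%:R^-1 *:
    (\sum_(l <- stencil Nm Np) (l%:~R ^+ s) *: alphaI R Nm Np l - 'X^s)).
Proof.
move=> NK sK; rewrite scalerBr linearB /= addrC reconXn // -sumrN; congr (_ + _).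
  by apply: eq_bigr => k _; rewrite mulNr scaleNr.
set L := \sum_(l <- stencil Nm Np) _.
have sL : (size (s`!%:R^-1 *: L) <= (width Nm Np).+1)%N.
  exact: leq_trans (size_scale_leq _ _) (size_lincomb_alphaI _ _ _).
rewrite (reconE sL NK); apply: eq_bigr => m _; congr (_ *: _).
apply: eq_bigr => k _; rewrite coefZ /L coef_sum.
have -> : \sum_(l <- stencil Nm Np) (l%:~R ^+ s *: alphaI R Nm Np l)`_(m + 2 * k)
    = nu R Nm Np (m + 2 * k) s.
  by apply: eq_bigr => l _; rewrite coefZ mulrC.
by rewrite invfM; ring.
Qed.

(** Only [j = 0] remains, and its factor is [(X + 1/2) - (X - 1/2) = 1]. *)
Lemma lambdaR1_next Nm Np : lambdaR1 R Nm Np (width Nm Np).+1 =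
  muR1 R Nm Np (width Nm Np).+1.
Proof.
rewrite /lambdaR1 subSnn big_ord1 subn0 !expr1 divr1 scaleN1r.
rewrite opprB addrAC opprD opprK addrA subrr add0r.
rewrite -polyCD; have -> : 2^-1 + 2^-1 = 1 :> R by field.
by rewrite mulr1.
Qed.

Lemma lambdaR1E K Nm Np : ((width Nm Np).+1 < K)%N ->
  lambdaR1 R Nm Np (width Nm Np).+1 =
  - recon K (((width Nm Np).+1)`!%:R^-1 *: nodal Nm Np).
Proof.
move=> NK; rewrite lambdaR1_next (@muR1E K) ?interpolation_error //; last exact: ltnW.
by rewrite addrAC subrr add0r scalerN linearN.
Qed.

End Reconstruction.

Theorem proposition3p10 (R : realType) (Mm Mp : int) (M : nat)
    (hM : Mm + Mp = M%:Z) (hM2 : (2 <= M)%N) :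
  [/\ alphaR1 R (Mm - 1) Mp Mp
        = (-1) ^+ (M - 1) *: alphaR1 R Mm (Mp - 1) (- Mm),
      (forall l : int, - Mm + 1 <= l <= Mp - 1 ->
        alphaR1 R Mm (Mp - 1) l <> alphaR1 R (Mm - 1) Mp l),
      lambdaR1 R (Mm - 1) Mp M = (-1) ^+ (M - 1) *: alphaR1 R Mm Mp (- Mm),
      lambdaR1 R Mm (Mp - 1) M = - alphaR1 R Mm Mp Mp
    & (alphaR1 R (Mm - 1) Mp Mp
         = lambdaR1 R (Mm - 1) Mp M - lambdaR1 R Mm (Mp - 1) M)
      /\ (alphaR1 R (Mm - 1) Mp Mp <> 0)].
Proof.
have wL : width (Mm - 1) Mp = (M - 1)%N by rewrite /width; lia.
have wR : width Mm (Mp - 1) = (M - 1)%N by rewrite /width; lia.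
have wM : width Mm Mp = M by rewrite /width; lia.
have M1 : M = (M - 1).+1 by lia.
(* [Q] vanishes at the [M - 1] nodes shared by the two shifted stencils. The order [M.+2] exceeds
   every degree below, so one injective operator serves throughout. *)
pose Q := nodal R (Mm - 1) (Mp - 1).
have aE : alphaR1 R (Mm - 1) Mp Mp = recon M.+2 ((M - 1)`!%:R^-1 *: Q).
  rewrite (@alphaR1E _ M.+2) ?mem_stencil ?wL; try lia.
  by rewrite alphaI_right ?wL //; lia.
have lL : lambdaR1 R (Mm - 1) Mp M
    = - recon M.+2 (M`!%:R^-1 *: nodal R (Mm - 1) Mp).
  by have := @lambdaR1E R M.+2 (Mm - 1) Mp; rewrite wL -M1; apply; lia.
have lR : lambdaR1 R Mm (Mp - 1) M
    = - recon M.+2 (M`!%:R^-1 *: nodal R Mm (Mp - 1)).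
  by have := @lambdaR1E R M.+2 Mm (Mp - 1); rewrite wR -M1; apply; lia.
split.
- rewrite aE (@alphaR1E _ M.+2 Mm) ?mem_stencil ?wR; try lia.
  rewrite alphaI_left ?wR; last by lia.
  by rewrite -[in RHS]linearZ /= scalerA mulrA -signr_odd -expr2 sqrr_sign mul1r.
(* The node [- Mm] belongs to the first stencil only: it is a root of the first interpolation
   polynomial but not of the second. *)
- move=> l lM; rewrite !(@alphaR1E _ M.+2) ?mem_stencil ?wR ?wL; try lia.
  move/recon_inj => /(_ isT) E.
  have off : - Mm \notin stencil (Mm - 1) Mp by rewrite mem_stencil; lia.
  have := @alphaI_neq0_off R _ _ l _ off.
  by rewrite -E root_alphaI ?mem_stencil ?eqxx //; lia.
- rewrite lL (@alphaR1E _ M.+2) ?mem_stencil ?wM; try lia.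
  rewrite alphaI_left ?wM; last by lia.
  rewrite -[in RHS]linearZ /= scalerA mulrA -exprD -linearN /= -scaleNr.
  (* The exponent [(M - 1) + M] is odd, which yields the minus sign of [lL]. *)
  by rewrite -signr_odd oddD oddB ?addbK; last lia; rewrite addbC addKb expr1 mulN1r.
- rewrite lR (@alphaR1E _ M.+2) ?mem_stencil ?wM; try lia.
  by rewrite alphaI_right ?wM //; lia.
split; last first.
  rewrite aE -(linear0 (recon M.+2)) => /recon_inj => /(_ isT)/eqP.
  rewrite scaler_eq0 invr_eq0 pnatr_eq0 eqn0Ngt fact_gt0 /=.
  exact/negP/nodal_neq0.
rewrite aE lL lR opprK addrC -linearB /=; congr (recon _ _).
(* The two nodal polynomials are [(X + Mm) Q] and [(X - Mp) Q]; their difference is [M Q], and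
   [M / M! = 1 / (M - 1)!]. *)
rewrite nodal_left; last by lia.
rewrite (@nodal_right _ (Mm - 1) Mp) -/Q; last by lia.
rewrite -scalerBr mulrC -mulrBr opprB addrC addrA subrK -polyCN -polyCD.
rewrite -rmorphN -rmorphD opprK (addrC Mp) hM mulrC mul_polyC scalerA.
have fM : M`! = (M * (M - 1)`!)%N by rewrite [in LHS]M1 factS -M1.
congr (_ *: _); rewrite /= fM natrM invfM -pmulrn mulrAC mulVf ?mul1r //.
by rewrite pnatr_eq0; lia.
Qed.
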